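(* Let $X\in\mathbb R^{n\times p}$, $Y\in\mathbb R^{n\times m}$, $\Gamma\in\mathbb R^{m\times m}$ be any given finite data with $\Gamma$ (symmetric) positive definite and $X\neq 0$, and let $r\ge 1$. Let $\hat B(r)$ be a reduced-rank regression estimator, i.e. a solution of $$\min_{B\in\mathbb R^{p\times m}}\ \mathrm{tr}\{(Y-XB)\Gamma(Y-XB)^{T}\}\quad\text{subject to } \mathrm{rank}(B)\le r .$$ Then its finite-sample breakdown point is exactly $\epsilon^*\{\hat B(r)\}=1/n$. Furthermore, let $\hat B(\lambda)$ be any estimator satisfying $$\hat B(\lambda)\in\arg\min_{B\in\mathbb R^{p\times m}}\ \tfrac12\mathrm{tr}\{(Y-XB)\Gamma(Y-XB)^{T}\}+\sum_{s=1}^{p\wedge m}P\big(\sigma_s^{B\Gamma^{1/2}};\lambda\big),$$ where $\sigma_s^{B\Gamma^{1/2}}$ are the singular values of $B\Gamma^{1/2}$ and the penalty $P$ is constructed from an arbitrary threshold function $\Theta(\cdot;\lambda)$ by $$P(t;\lambda)-P(0;\lambda)=P_\Theta(t;\lambda)+q(t;\lambda),\qquad P_\Theta(t;\lambda)=\int_0^{|t|}\big[\sup\{s:\Theta(s;\lambda)\le u\}-u\big]\,du,$$ for some nonnegative function $q(\cdot;\lambda)$ with $q\{\Theta(s;\lambda);\lambda\}=0$ for all $s\in\mathbb R$. Then $\epsilon^*\{\hat B(\lambda)\}=1/n$ still holds for any finite value of $\lambda$.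
   Context: Threshold function: a real-valued function $\Theta(t;\lambda)$ defined for $-\infty<t<\infty$ and $0\le\lambda<\infty$ such that (i) $\Theta(-t;\lambda)=-\Theta(t;\lambda)$; (ii) $\Theta(t;\lambda)\le\Theta(t';\lambda)$ for $t\le t'$; (iii) $\lim_{t\to\infty}\Theta(t;\lambda)=\infty$; (iv) $0\le\Theta(t;\lambda)\le t$ for $0\le t<\infty$. Finite-sample breakdown point: given finite data $(X,Y,\Gamma)$ and an estimator $\hat B(X,Y,\Gamma)$ (regarded as a function of the data), $$\epsilon^*(\hat B)=\frac1n\min\Big\{k\in\mathbb N\cup\{0\}:\ \sup_{\tilde Y\in\mathbb R^{n\times m}:\ \|\tilde Y-Y\|_0\le k}\|X\hat B(X,\tilde Y,\Gamma)\|_F=+\infty\Big\},$$ where $\|A\|_0$ is the number of nonzero entries of a matrix $A$ and $\|\cdot\|_F$ is the Frobenius norm. Also $a\wedge b=\min(a,b)$. *)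

(* Defs.v *)
From HB Require Import structures.
From mathcomp Require Import all_boot all_order all_algebra.
From mathcomp Require Import polyrcf.
From mathcomp Require Import all_classical all_reals all_analysis.

Set Implicit Arguments.
Unset Strict Implicit.
Unset Printing Implicit Defensive.

Import Order.TTheory GRing.Theory Num.Theory.
Import numFieldNormedType.Exports.
Local Open Scope classical_set_scope.
Local Open Scope ring_scope.

Definition frobenius_norm (R : realType) (n m : nat) (A : 'M[R]_(n, m)) : R :=
  Num.sqrt (\sum_(i < n) \sum_(j < m) A i j ^+ 2).

Definition nnz (R : realType) (n m : nat) (A : 'M[R]_(n, m)) : nat :=
  #|[pred ij : 'I_n * 'I_m | A ij.1 ij.2 != 0]|.

Definition posdefmx (R : realType) (m : nat) (A : 'M[R]_m) : Prop :=
  A^T = A /\ forall v : 'cV[R]_m, v != 0 -> 0 < (v^T *m A *m v) ord0 ord0.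

(* A positive definite [A] has exactly one positive definite square root, so
   the choice made by [xget] is irrelevant and its default is not used. *)
Definition sqrtmx (R : realType) (m : nat) (A : 'M[R]_m) : 'M[R]_m :=
  xget 0 [set S : 'M[R]_m | posdefmx S /\ S *m S = A].

(* All the real eigenvalues, repeated according to their multiplicity as roots
   of the characteristic polynomial, in nonincreasing order. *)
Definition real_eigenvalues (R : realType) (m : nat) (A : 'M[R]_m) : seq R :=
  sort >=%R
    (flatten [seq nseq (mup x (char_poly A)) x | x <- rootsR (char_poly A)]).

(* [A^T *m A] has [m] nonnegative real eigenvalues; the [minn p m] singular
   values of [A] are the square roots of the largest ones, so [s] below is
   meant to range over [0 <= s < minn p m]. *)
Definition singular_value (R : realType) (p m : nat) (A : 'M[R]_(p, m))
    (s : nat) : R :=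
  Num.sqrt (nth 0 (real_eigenvalues (A^T *m A)) s).

Definition estimator (R : realType) (n p m : nat) : Type :=
  'M[R]_(n, p) -> 'M[R]_(n, m) -> 'M[R]_m -> 'M[R]_(p, m).

(* The minimum over [k] is an infimum in the extended reals, hence [+oo] when
   no [k] breaks the estimator down. *)
Definition breakdown_point (R : realType) (n p m : nat)
    (Bhat : estimator R n p m)
    (X : 'M[R]_(n, p)) (Y : 'M[R]_(n, m)) (Gamma : 'M[R]_m) : \bar R :=
  ((n%:R^-1)%:E *
   ereal_inf [set (k%:R)%:E | k in [set k : nat |
     ereal_sup [set (frobenius_norm (X *m Bhat X Yt Gamma))%:E |
       Yt in [set Yt : 'M[R]_(n, m) | (nnz (Yt - Y) <= k)%N]] = +oo]])%E.

Definition is_argmin (R : realType) (T : Type) (D : set T) (f : T -> R)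
    (x : T) : Prop :=
  D x /\ forall y, D y -> f x <= f y.

Definition weighted_loss (R : realType) (n p m : nat) (X : 'M[R]_(n, p))
    (Y : 'M[R]_(n, m)) (Gamma : 'M[R]_m) (B : 'M[R]_(p, m)) : R :=
  \tr ((Y - X *m B) *m Gamma *m (Y - X *m B)^T).

Definition rrr_solution (R : realType) (n p m r : nat) (X : 'M[R]_(n, p))
    (Y : 'M[R]_(n, m)) (Gamma : 'M[R]_m) (B : 'M[R]_(p, m)) : Prop :=
  is_argmin [set B : 'M[R]_(p, m) | (\rank B <= r)%N]
    (weighted_loss X Y Gamma) B.

(* Functions of [(t; lambda)] are total in [lambda]; only their values at
   [0 <= lambda] are constrained. *)
Definition threshold_function (R : realType) (Theta : R -> R -> R) : Prop :=
  forall lambda : R, 0 <= lambda ->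
    [/\ forall t, Theta (- t) lambda = - Theta t lambda,
        forall t t', t <= t' -> Theta t lambda <= Theta t' lambda,
        Theta t lambda @[t --> +oo] --> +oo &
        forall t : R, 0 <= t -> 0 <= Theta t lambda /\ Theta t lambda <= t].

(* For a threshold function and [0 <= u], the set below contains [u] and is
   bounded above, so that [sup] is a genuine supremum; the integrand is a
   difference of nondecreasing functions, hence integrable on [0, |t|]. *)
Definition threshold_penalty (R : realType) (Theta : R -> R -> R)
    (t lambda : R) : R :=
  \int[lebesgue_measure]_(u in `[0, `|t|])
     (sup [set s : R | Theta s lambda <= u] - u).

Definition penalty_induced_by (R : realType) (Theta P : R -> R -> R) : Prop :=
  exists q : R -> R -> R, forall lambda : R, 0 <= lambda ->
    [/\ forall t, 0 <= q t lambda,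
        forall s, q (Theta s lambda) lambda = 0 &
        forall t, P t lambda - P 0 lambda
                  = threshold_penalty Theta t lambda + q t lambda].

Definition penalized_objective (R : realType) (n p m : nat) (P : R -> R -> R)
    (lambda : R) (X : 'M[R]_(n, p)) (Y : 'M[R]_(n, m)) (Gamma : 'M[R]_m)
    (B : 'M[R]_(p, m)) : R :=
  2^-1 * weighted_loss X Y Gamma B
  + \sum_(s < minn p m) P (singular_value (B *m sqrtmx Gamma) s) lambda.

Definition penalized_solution (R : realType) (n p m : nat) (P : R -> R -> R)
    (lambda : R) (X : 'M[R]_(n, p)) (Y : 'M[R]_(n, m)) (Gamma : 'M[R]_m)
    (B : 'M[R]_(p, m)) : Prop :=
  is_argmin setT (penalized_objective P lambda X Y Gamma) B.

(* Main.v *)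
(** Corrupt the single entry [(i, j)] of [Y] by an amount [t]. Up to the square
    of [Y + t E_ij], which does not depend on [B], the loss at a fixed [B] is
    affine in [t] with slope [- 2 <E_ij, X B>], where
    [<A, C> = tr (A Gamma C^T)]. If the fits stayed bounded, so would be the
    slopes at the minimizers; but some rank-one [B0] has a fit with a strictly
    larger [<E_ij, X B0>]. The penalty is bounded below, because
    [Theta (u) <= u] gives [sup {s | Theta (s) <= u} >= u]; so [B0] beats the
    minimizer for large [t]. *)
Require Import Defs.
From mathcomp Require Import all_boot all_order all_algebra.
From mathcomp Require Import all_classical all_reals all_analysis.
From mathcomp Require Import ring lra.
Import Order.TTheory GRing.Theory Num.Theory.
Import numFieldNormedType.Exports.
Local Open Scope ring_scope.

(** It has the very shape of [weighted_loss], so the loss is by mere folding the square of the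
    residual [Y - X *m B]. *)
Definition weighted_ip {R : realType} {n m : nat} (Gamma : 'M[R]_m)
    (A C : 'M[R]_(n, m)) : R := \tr (A *m Gamma *m C^T).

Section WeightedInnerProduct.
Context {R : realType} {n m : nat} {Gamma : 'M[R]_m}.
Implicit Types A C D : 'M[R]_(n, m).
Local Notation ip := (weighted_ip Gamma).

Lemma weighted_ipC A C : Gamma^T = Gamma -> ip A C = ip C A.
Proof.
by move=> GT; rewrite /weighted_ip -mxtrace_tr !trmx_mul trmxK GT mulmxA.
Qed.

Lemma weighted_ipDl A C D : ip (A + C) D = ip A D + ip C D.
Proof. by rewrite /weighted_ip !mulmxDl mxtraceD. Qed.

Lemma weighted_ipZl (t : R) A C : ip (t *: A) C = t * ip A C.
Proof. by rewrite /weighted_ip -!scalemxAl mxtraceZ. Qed.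

Lemma weighted_ipZr (t : R) A C : ip A (t *: C) = t * ip A C.
Proof. by rewrite /weighted_ip linearZ -scalemxAr mxtraceZ. Qed.

Lemma weighted_ip_sqrB A C : Gamma^T = Gamma ->
  ip (A - C) (A - C) = ip A A - 2 * ip A C + ip C C.
Proof.
move=> GT; have ipB U : ip (A - C) U = ip A U - ip C U.
  by rewrite weighted_ipDl -scaleN1r weighted_ipZl mulN1r.
rewrite ipB ![ip _ (A - C)]weighted_ipC // !ipB (weighted_ipC C A) //.
ring.
Qed.

Lemma weighted_ipE A C : ip A C = \sum_i \sum_j (A *m Gamma) i j * C i j.
Proof.
rewrite /weighted_ip /mxtrace; apply: eq_bigr => i _; rewrite mxE.
by apply: eq_bigr => j _; rewrite [C^T _ _]mxE.
Qed.

Lemma weighted_ip_ge0 A : posdefmx Gamma -> 0 <= ip A A.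
Proof.
case=> _ Gpos; rewrite /weighted_ip /mxtrace; apply: sumr_ge0 => i _.
(* Each diagonal entry is the quadratic form of [Gamma] at a row of [A]. Zero rows are treated
   apart, since [posdefmx] only speaks of nonzero vectors. *)
have -> : (A *m Gamma *m A^T) i i
    = (((row i A)^T)^T *m Gamma *m (row i A)^T) ord0 ord0.
  by rewrite trmxK -row_mul !mxE; apply: eq_bigr => j _; rewrite !mxE.
have [->|/Gpos/ltW//] := eqVneq (row i A)^T 0.
by rewrite mulmx0 mxE.
Qed.

(** The bound depends on [C] only through [M], so it is uniform over all fits with entries bounded
    by [M]. *)
Lemma weighted_ip_bounded A C (M : R) : (forall i j, `|C i j| <= M) ->
  `|ip A C| <= M * \sum_i \sum_j `|(A *m Gamma) i j|.
Proof.
move=> CM; rewrite weighted_ipE mulr_sumr.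
apply: le_trans (ler_norm_sum _ _ _) _; apply: ler_sum => i _.
rewrite mulr_sumr; apply: le_trans (ler_norm_sum _ _ _) _.
apply: ler_sum => j _.
by rewrite normrM mulrC ler_wpM2r.
Qed.

Lemma weighted_ip_delta i j A : ip (delta_mx i j) A = \sum_k Gamma j k * A i k.
Proof.
rewrite weighted_ipE (bigD1 i) //= [X in _ + X]big1 ?addr0 => [|i' ni].
  apply: eq_bigr => k _; rewrite mxE (bigD1 j) //= big1 => [|l nl].
    by rewrite mxE !eqxx mul1r addr0.
  by rewrite mxE (negbTE nl) andbF mul0r.
apply: big1 => k _; rewrite mxE big1 ?mul0r // => l _.
by rewrite mxE (negbTE ni) mul0r.
Qed.

End WeightedInnerProduct.

Lemma posdefmx_diag_gt0 {R : realType} {m : nat} {Gamma : 'M[R]_m} (j : 'I_m) :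
  posdefmx Gamma -> 0 < Gamma j j.
Proof.
case=> _ /(_ (delta_mx j ord0)).
have -> : (delta_mx j ord0 : 'cV[R]_m) != 0.
  by apply/eqP => /matrixP/(_ j ord0)/eqP; rewrite !mxE !eqxx oner_eq0.
by rewrite trmx_delta -rowE -colE !mxE; apply.
Qed.

Lemma frobenius_norm_ge_entry {R : realType} {n m : nat} (A : 'M[R]_(n, m)) i j :
  `|A i j| <= frobenius_norm A.
Proof.
rewrite -sqrtr_sqr ler_wsqrtr // (bigD1 i) //= (bigD1 j) //= -addrA lerDl.
rewrite addr_ge0 // sumr_ge0 // => i' _; first exact: sqr_ge0.
by apply: sumr_ge0 => j' _; exact: sqr_ge0.
Qed.

Lemma nnz_scale_delta {R : realType} {n m : nat} (t : R) (i : 'I_n) (j : 'I_m) :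
  (nnz (t *: delta_mx i j) <= 1)%N.
Proof.
rewrite -(card1 (i, j)); apply/subset_leq_card/fintype.subsetP => -[a b].
rewrite !inE /= !mxE xpair_eqE; apply: contraR => /negbTE ->.
by rewrite mulr0.
Qed.

Lemma nnz_eq0 {R : realType} {n m : nat} (A : 'M[R]_(n, m)) :
  (nnz A <= 0)%N -> A = 0.
Proof.
rewrite leqn0 => /eqP/card0_eq A0; apply/matrixP => i j.
by have := A0 (i, j); rewrite !inE mxE => /negbFE/eqP.
Qed.

Section OneCorruptedEntry.
Context {R : realType} {n p m : nat} {X : 'M[R]_(n, p)} {Y : 'M[R]_(n, m)}.
Context {Gamma : 'M[R]_m} {Bhat : estimator R n p m}.
Hypothesis (m_gt0 : (0 < m)%N) (Gamma_posdef : posdefmx Gamma) (X_neq0 : X != 0).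

(** A multiple of [delta_mx k j] puts a multiple of column [k] of [X] into column [j] of the fit.
    The product is then that multiple times [Gamma j j * X i k], which is nonzero, so a suitable
    scaling reaches every [c]. *)
Lemma rank_one_fit_ip (i : 'I_n) (j : 'I_m) (k : 'I_p) (c : R) : X i k != 0 ->
  exists2 B : 'M[R]_(p, m), (\rank B <= 1)%N &
    weighted_ip Gamma (delta_mx i j) (X *m B) = c.
Proof.
move=> Xik; have Gjj := posdefmx_diag_gt0 j Gamma_posdef.
exists ((c / (Gamma j j * X i k)) *: delta_mx k j).
  apply: leq_trans (mxrankS (scalemx_sub _ (submx_refl _))) _.
  by rewrite mxrank_delta.
rewrite -scalemxAr weighted_ipZr weighted_ip_delta (bigD1 j) //=.
rewrite big1 ?addr0 => [|l nl].
  rewrite mxE (bigD1 k) //= big1 ?addr0 => [|l nl].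
    by rewrite mxE !eqxx mulr1 divfK // mulf_neq0 // gt_eqF.
  by rewrite mxE (negbTE nl) mulr0.
by rewrite mxE big1 ?mulr0 // => h _; rewrite mxE (negbTE nl) andbF mulr0.
Qed.

(** The parameters [D], [a] and [pen] cover the rank-constrained and the penalized estimator at
    once. *)
Lemma one_entry_unbounded (D : set 'M[R]_(p, m)) (a c : R)
    (pen : 'M[R]_(p, m) -> R) : 0 < a ->
  (forall B, (\rank B <= 1)%N -> D B) ->
  (forall B, c <= pen B) ->
  (forall Yt, is_argmin D (fun B => a * weighted_loss X Yt Gamma B + pen B)
     (Bhat X Yt Gamma)) ->
  forall M : R, exists2 Yt, (nnz (Yt - Y) <= 1)%N &
    M < frobenius_norm (X *m Bhat X Yt Gamma).
Proof.
move=> a_gt0 DB penc opt M; apply: contrapT => bnd.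
have {}bnd Yt : (nnz (Yt - Y) <= 1)%N ->
    forall i j, `|(X *m Bhat X Yt Gamma) i j| <= M.
  move=> nYt i j; apply: le_trans (frobenius_norm_ge_entry _ i j) _.
  by rewrite leNgt; apply/negP => Mlt; apply: bnd; exists Yt.
have [i [k Xik]] : exists i k, X i k != 0.
  apply: contrapT => X0; move/eqP: X_neq0; apply; apply/matrixP => i k.
  by rewrite mxE; apply: contrapT => /eqP ?; apply: X0; exists i, k.
pose E : 'M[R]_(n, m) := delta_mx i (Ordinal m_gt0).
pose S (A : 'M[R]_(n, m)) := \sum_i \sum_j `|(A *m Gamma) i j|.
(* Fits with entries bounded by [M] have product at most [M * S E] with [E]; [B0] exceeds this by
   1. *)
have [B0 rB0 ipB0] := rank_one_fit_ip i (Ordinal m_gt0) k (M * S E + 1) Xik.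
(* [K] collects the terms free of [t]: the loss at the minimizer exceeds that at [B0] by at least
   [2 * t - K]. *)
pose K := weighted_ip Gamma (X *m B0) (X *m B0)
          - 2 * weighted_ip Gamma Y (X *m B0) + 2 * (M * S Y).
(* Optimality will give [2 * t <= (pen B0 - c) / a + K], whose right side is less than [t]; as [t]
   is positive, this is absurd. *)
pose t := `|(pen B0 - c) / a + K| + 1.
pose Yt := Y + t *: E.
have nYt : (nnz (Yt - Y) <= 1)%N by rewrite addrC addKr nnz_scale_delta.
have := (opt Yt).2 B0 (DB _ rB0).
have := weighted_ip_bounded (Gamma := Gamma) E _ M (bnd _ nYt).
have := weighted_ip_bounded (Gamma := Gamma) Y _ M (bnd _ nYt).
rewrite /weighted_loss -/(weighted_ip _ _ _) -/(weighted_ip _ _ _).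
have GT := Gamma_posdef.1.
rewrite -/(S E) -/(S Y); set B := Bhat X Yt Gamma.
rewrite !weighted_ip_sqrB // {2 5}/Yt !(weighted_ipDl Y) !weighted_ipZl ipB0.
move=> /(le_trans (ler_norm _)) hY /(le_trans (ler_norm _)) hE.
have hB := weighted_ip_ge0 (X *m B) Gamma_posdef.
have t_gt0 : 0 < t by rewrite ltr_wpDl.
have tK : (pen B0 - c) / a + K < t by rewrite /t ltr_pwDr // ler_norm.
have htE := ler_wpM2l (ltW t_gt0) hE.
move=> opt0; have := penc B => hpen.
have : 2 * t - K <= (pen B0 - c) / a.
  rewrite ler_pdivlMr // mulrC.
  set W := weighted_ip Gamma Yt Yt in opt0.
  set x := weighted_ip Gamma Y (X *m B) in hY opt0.
  set y := weighted_ip Gamma E (X *m B) in hE htE opt0.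
  set z := weighted_ip Gamma (X *m B) (X *m B) in hB opt0.
  set u := weighted_ip Gamma Y (X *m B0) in opt0 *.
  set v := weighted_ip Gamma (X *m B0) (X *m B0) in opt0 *.
  (* [W] cancels, [z] is nonnegative, and [x], [y] are at most [M * S Y], [M * S E]; the surplus 1
     of [B0] leaves [2 * t]. *)
  have h : 2 * t - K <= (W - 2 * (x + t * y) + z)
                        - (W - 2 * (u + t * (M * S E + 1)) + v).
    rewrite /K -/u -/v; lra.
  apply: le_trans (ler_wpM2l (ltW a_gt0) h) _; rewrite mulrBr; lra.
lra.
Qed.

Lemma breakdown_point_one_entry :
  (forall M : R, exists2 Yt, (nnz (Yt - Y) <= 1)%N &
    M < frobenius_norm (X *m Bhat X Yt Gamma)) ->
  breakdown_point Bhat X Y Gamma = (n%:R^-1)%:E.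
Proof.
move=> unb; rewrite /breakdown_point.
suff -> : ereal_inf [set (k%:R : R)%:E | k in [set k : nat |
     ereal_sup [set (frobenius_norm (X *m Bhat X Yt Gamma))%:E |
       Yt in [set Yt : 'M[R]_(n, m) | (nnz (Yt - Y) <= k)%N]] = +oo%E]]%classic
    = 1%:E by rewrite mule1.
apply/eqP; rewrite eq_le; apply/andP; split.
  apply: ereal_inf_lbound; exists 1%N => //=.
  apply/eqyP => A _; have [Yt nYt MYt] := unb A.
  apply: le_trans (ereal_sup_ubound _); last by exists Yt.
  by rewrite lee_fin ltW.
(* Only [k = 0] could go below 1, but then [Y] is the sole admissible response and the supremum is
   one finite norm. *)
apply: le_ereal_inf_tmp => _ [[|k] /= Hk <-]; last by rewrite lee_fin ler1n.
suff S0 : [set (frobenius_norm (X *m Bhat X Yt Gamma))%:E |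
    Yt in [set Yt : 'M[R]_(n, m) | (nnz (Yt - Y) <= 0)%N]]%classic
    = [set (frobenius_norm (X *m Bhat X Y Gamma))%:E]%classic.
  by move: Hk; rewrite S0 ereal_sup1.
apply/seteqP; split => [_ [Yt /= /nnz_eq0 YtY <-]|_ ->].
  by move/eqP: YtY; rewrite subr_eq0 => /eqP ->.
exists Y => //=; rewrite subrr leqn0; apply/eqP/eq_card0 => ij.
by rewrite !inE mxE eqxx.
Qed.

End OneCorruptedEntry.

(** The integrand is nonnegative: [Theta u lambda <= u] puts [u] itself in the set whose supremum is
    taken. *)
Lemma threshold_penalty_ge0 (R : realType) (Theta : R -> R -> R) (t lambda : R) :
  threshold_function Theta -> 0 <= lambda ->
  0 <= threshold_penalty Theta t lambda.
Proof.
move=> Th /Th[_ _ Thoo Thle]; apply: Rintegral_ge0 => u /=.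
rewrite in_itv /= => /andP[u_ge0 _]; rewrite subr_ge0.
apply: ub_le_sup; last by case: (Thle u u_ge0).
(* Divergence of [Theta] bounds the set above; otherwise [sup] would take its default value 0. *)
have [A [_ AP]] := (cvgryPgt _).1 Thoo u.
exists A => s /= Thsu; rewrite leNgt; apply/negP => /AP.
by rewrite ltNge Thsu.
Qed.

Lemma penalty_induced_by_ge (R : realType) (Theta P : R -> R -> R) (t lambda : R) :
  threshold_function Theta -> penalty_induced_by Theta P -> 0 <= lambda ->
  P 0 lambda <= P t lambda.
Proof.
move=> Th [q Pq] l0; have [q0 _ PE] := Pq _ l0.
by rewrite -subr_ge0 PE addr_ge0 // threshold_penalty_ge0.
Qed.

Theorem theorem1 (R : realType) (n p m : nat) (m_gt0 : (0 < m)%N)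
    (X : 'M[R]_(n, p)) (Y : 'M[R]_(n, m)) (Gamma : 'M[R]_m)
    (Gamma_posdef : posdefmx Gamma) (X_neq0 : X != 0) :
  (forall (r : nat) (Bhat : estimator R n p m),
     (1 <= r)%N ->
     (forall Yt : 'M[R]_(n, m), rrr_solution r X Yt Gamma (Bhat X Yt Gamma)) ->
     breakdown_point Bhat X Y Gamma = (n%:R^-1)%:E) /\
  (forall (Theta P : R -> R -> R),
     threshold_function Theta ->
     penalty_induced_by Theta P ->
     forall (lambda : R) (Bhat : estimator R n p m),
     0 <= lambda ->
     (forall Yt : 'M[R]_(n, m),
        penalized_solution P lambda X Yt Gamma (Bhat X Yt Gamma)) ->
     breakdown_point Bhat X Y Gamma = (n%:R^-1)%:E).
Proof.
split=> [r Bhat r_ge1 opt|Theta P Th ThP lambda Bhat l0 opt];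
    apply: breakdown_point_one_entry.
  (* No penalty here; rank-one competitors are feasible because [1 <= r]. *)
  apply: (@one_entry_unbounded _ _ _ _ _ _ _ _ m_gt0 Gamma_posdef X_neq0
    [set B | (\rank B <= r)%N]%classic 1 0 (fun=> 0)) => // [B rB|Yt].
    exact: leq_trans rB r_ge1.
  by have [? optY] := opt Yt; split=> // B /optY; rewrite !mul1r !addr0.
(* The penalty is bounded below termwise by its value at zero singular values. *)
apply: (@one_entry_unbounded _ _ _ _ _ _ _ _ m_gt0 Gamma_posdef X_neq0
  setT 2^-1 (\sum_(s < minn p m) P 0 lambda)
  (fun B => \sum_(s < minn p m) P (singular_value (B *m sqrtmx Gamma) s) lambda)).
- by rewrite invr_gt0.
- by [].
- by move=> B; apply: ler_sum => s _; apply: penalty_induced_by_ge ThP l0.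
- exact: opt.
Qed.
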